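(* Let $\mathscr{I}$ be a non-empty set. For each $i\in\mathscr{I}$ let $\lambda_i\geqslant 1$ be a cardinal, let $S_i$ be a Hausdorff pseudocompact (resp., countably pracompact) topological monoid with zero, and let $B^0_{\lambda_i}(S_i)$ be a Hausdorff pseudocompact (resp., countably pracompact) topological Brandt $\lambda_i^0$-extension of $S_i$ in the class of Hausdorff topological semigroups. Suppose that the Tychonoff product $\prod\{S_i\colon i\in\mathscr{I}\}$ is a Hausdorff pseudocompact (resp., countably pracompact) space. Then the direct product $\prod\{B^0_{\lambda_i}(S_i)\colon i\in\mathscr{I}\}$ with the Tychonoff topology is a Hausdorff pseudocompact (resp., countably pracompact) topological semigroup.
   Context: The statement comprises two assertions: one with ''pseudocompact'' throughout and one with ''countably pracompact'' throughout. All topological spaces are Hausdorff. A topological semigroup is a Hausdorff topological space with a jointly continuous associative operation; a topological monoid is a topological semigroup with identity. Direct products of semigroups carry the coordinatewise operation. Brandt $\lambda^0$-extension: for a monoid $S$ with zero $0_S$ and a cardinal $\lambda\geqslant 1$, $B^0_\lambda(S)$ is the set $\{(\alpha,s,\beta)\colon \alpha,\beta\in\lambda,\ s\in S\setminus\{0_S\}\}\sqcup\{0\}$ with the operation in which $0$ is the zero and $(\alpha,a,\beta)\cdot(\gamma,b,\delta)$ equals $(\alpha,ab,\delta)$ if $\beta=\gamma$ and $ab\neq 0_S$, and equals $0$ otherwise. For $\alpha,\beta\in\lambda$ put $S_{\alpha,\beta}=\{(\alpha,s,\beta)\colon s\in S\setminus\{0_S\}\}\cup\{0\}$. Topological Brandt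 $\lambda^0$-extension in the class of Hausdorff topological semigroups: for a topological monoid $(S,\tau)$ with zero, it is $B^0_\lambda(S)$ with a Hausdorff topology $\tau_B$ such that $(B^0_\lambda(S),\tau_B)$ is a topological semigroup and, for some $\alpha\in\lambda$, the map $0_S\mapsto 0$, $s\mapsto(\alpha,s,\alpha)$ ($s\neq 0_S$) is a homeomorphism of $(S,\tau)$ onto the subspace $S_{\alpha,\alpha}$. A Hausdorff space is pseudocompact if every locally finite family of non-empty open subsets of it is finite (equivalently, each locally finite open cover is finite); no Tychonoff separation is assumed. A space $X$ is countably compact at a subset $A\subseteq X$ if every infinite subset $B\subseteq A$ has an accumulation point in $X$; $X$ is countably pracompact if it is countably compact at some dense subset $A$ of $X$. *)

(* Defs.v *)
From HB Require Import structures.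
From mathcomp Require Import all_boot all_order all_classical topology.

Set Implicit Arguments.
Unset Strict Implicit.
Unset Printing Implicit Defensive.

Local Open Scope classical_set_scope.
Local Open Scope group_scope.

Definition locally_finite (X : topologicalType) (F : set (set X)) : Prop :=
  forall x : X, exists2 U : set X,
    nbhs x U & finite_set [set V | F V /\ V `&` U !=set0].

Definition pseudocompact (X : topologicalType) : Prop :=
  forall F : set (set X),
    (forall U, F U -> open U /\ U !=set0) -> locally_finite F -> finite_set F.

Definition countably_compact_at (X : topologicalType) (A : set X) : Prop :=
  forall B : set X, B `<=` A -> infinite_set B -> limit_point B !=set0.

Definition countably_pracompact (X : topologicalType) : Prop :=
  exists2 A : set X, dense A & countably_compact_at A.

(* In the last clause [A] is coerced to a type, with the subspace topology. *)
Definition homeomorphism_onto (X Y : topologicalType) (A : set Y) (f : X -> Y)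
    : Prop :=
  [/\ set_bij [set: X] A f, continuous f &
      exists2 g : A -> X, (forall y : A, f (g y) = set_val y) & continuous g].

HB.mixin Record Monoid_hasZero S of Monoid S := {
  mzero : S;
  mul0m : left_zero mzero (@mul S);
  mulm0 : right_zero mzero (@mul S)
}.

#[short(type="monoidWithZeroType")]
HB.structure Definition MonoidWithZero := {S of Monoid_hasZero S & Monoid S}.

(* No compatibility between operation and topology is required in the next two
   structures: see [topological_semigroup]. *)
#[short(type="preTopologicalSemigroupType")]
HB.structure Definition PreTopologicalSemigroup :=
  {T of Topological T & Semigroup T}.

#[short(type="preTopologicalMonoidWithZeroType")]
HB.structure Definition PreTopologicalMonoidWithZero :=
  {T of Topological T & MonoidWithZero T}.

Definition topological_semigroup (T : preTopologicalSemigroupType) : Prop :=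
  hausdorff_space T /\ continuous (fun p : T * T => p.1 * p.2).

Section DirectProduct.
Context (I : Type) (T : I -> preTopologicalSemigroupType).

Definition prod_mul (f g : prod_topology T) : prod_topology T :=
  fun i => f i * g i.

Fact prod_mulA : associative prod_mul.
Proof.
by move=> f g h; apply: functional_extensionality_dep => i; exact: mulgA.
Qed.

HB.instance Definition _ := hasMul.Build (prod_topology T) prod_mul.
HB.instance Definition _ := Magma_isSemigroup.Build (prod_topology T) prod_mulA.

End DirectProduct.

Section Brandt.
Context (L : choiceType) (S : monoidWithZeroType).

(* [None] is the zero of the extension. *)
Definition brandt : Type := option (L * {s : S | s != mzero} * L).

HB.instance Definition _ := Choice.on brandt.

(* The triple (a, s, b) if s is non-zero, and the zero otherwise. *)
Definition brandt_elt (a : L) (s : S) (b : L) : brandt :=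
  omap (fun u : {s : S | s != mzero} => (a, u, b)) (insub s).

Definition brandt_mul (x y : brandt) : brandt :=
  match x, y with
  | Some (a, s, b), Some (c, t, d) =>
      if b == c then brandt_elt a (val s * val t) d else None
  | _, _ => None
  end.

Definition brandt_block (a b : L) : set brandt :=
  [set x | x = None \/ exists u, x = Some (a, u, b)].

Fact brandt_mulA : associative brandt_mul.
Proof.
have mul_some p u q p' u' q' : brandt_mul (Some (p, u, q)) (Some (p', u', q')) =
    if q == p' then brandt_elt p (val u * val u') q' else None by [].
have mul_elt x c t d : brandt_mul x (brandt_elt c t d) =
    if x is Some (a, s, b) then
      if b == c then brandt_elt a (val s * t) d else None
    else None.
  case: x => [[[a s] b]|] //=; rewrite /brandt_elt.
  case: insubP => [u _ <-|/negPn/eqP ->] //=.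
  by rewrite mulm0 insubF ?eqxx //=; case: ifP.
have elt_mul c t d y : brandt_mul (brandt_elt c t d) y =
    if y is Some (a, s, b) then
      if d == a then brandt_elt c (t * val s) b else None
    else None.
  rewrite /brandt_elt; case: insubP => [u _ <-|/negPn/eqP ->] //=.
  case: y => [[[a s] b]|] //=.
  by rewrite mul0m insubF ?eqxx //=; case: ifP.
have mulN0 (x : brandt) : brandt_mul x None = None by case: x => [[[? ?] ?]|].
case=> [[[a s] b]|//] [[[c t] d]|//] [[[e u] f]|]; last by rewrite !mulN0.
rewrite !mul_some.
have [<-|neq_de] := eqVneq d e; have [eq_bc|neq_bc] := eqVneq b c.
- by rewrite mul_elt elt_mul eq_bc !eqxx mulgA.
- by rewrite mul_elt (negPf neq_bc).
- by rewrite mulN0 elt_mul (negPf neq_de).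
- by rewrite mulN0.
Qed.

HB.instance Definition _ := hasMul.Build brandt brandt_mul.
HB.instance Definition _ := Magma_isSemigroup.Build brandt brandt_mulA.

End Brandt.

Definition topologized (T : semigroupType) (tau : Topological T) : Type := T.

Section Topologized.
Context (T : semigroupType) (tau : Topological T).

HB.instance Definition _ :=
  Topological.copy (topologized tau) (Topological.Pack tau).
HB.instance Definition _ := hasMul.Build (topologized tau) (@mul T).
HB.instance Definition _ :=
  Magma_isSemigroup.Build (topologized tau) (@mulgA T).

End Topologized.

Definition topological_brandt_extension (L : choiceType)
    (S : preTopologicalMonoidWithZeroType) (tau : Topological (brandt L S))
    : Prop :=
  topological_semigroup (topologized tau) /\
  exists a : L, @homeomorphism_onto S (topologized tau) (brandt_block a a)
                  (fun s : S => brandt_elt a s a).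

(* Main.v *)
Require Import Defs.
From mathcomp Require Import all_boot all_order all_classical topology.

(** The product of the extensions is a continuous image of the product of a
    compact space with [prod_topology S], and both pseudocompactness and
    countable pracompactness are inherited by such images.

    The compact factor exists because a pseudocompact topological Brandt
    extension [B] of a monoid with [1 != 0] has a finite index set
    ([finite_index]).  Fix an index [a].  Every element [(a, 1, g)(g, 1, a)] is
    the same idempotent [(a, 1, a)], which differs from [0 = 0 * 0].  Separating
    the two by disjoint open sets and using the continuity of multiplication, one
    gets a neighbourhood [W] of zero such that for each [g] some open
    neighbourhood of [(a, 1, g)] or of [(g, 1, a)] misses [W].  The blocks minus
    zero are open and pairwise disjoint, so these neighbourhoods, cut down to
    their blocks, form a locally finite family, and pseudocompactness allows only
    finitely many of them.  This covers countably pracompact extensions too, as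
    they are pseudocompact ([countably_pracompact_pseudocompact]).

    Hence [B] is the union of finitely many blocks, each one the image of [S]
    under the continuous map [s |-> (a, s, b) = (a, 1, c)(c, s, c)(c, 1, b)], where
    [c] is the index at which [S] embeds.  If [1 = 0] in [S], then [B] is a
    single point and one block suffices.  So a finite set [A i] of pairs of
    indices, taken discrete, gives a continuous map of [A i * S i] onto the [i]-th
    extension, and the product of the [A i] is compact by Tychonoff's theorem.

    For a continuous map [f] of [K * X] onto [Y] with [K] compact, the shadow in
    [X] of a set [G] in [Y] is the set of the [x] with [f (z, x)] in [G] for some
    [z] in [K].  By the tube lemma the shadows of a locally finite family are
    again locally finite ([shadow_locally_finite]).  A locally finite family of
    non-empty open sets of [Y] is therefore finite as soon as [X] is
    pseudocompact; the same argument, applied to the points of a set without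
    limit points, transfers countable pracompactness. *)

Set Implicit Arguments.
Unset Strict Implicit.
Unset Printing Implicit Defensive.

Local Open Scope classical_set_scope.

(** * Locally finite indexed families *)

(** Families are indexed, unlike in [locally_finite], because different members
    of a family may have the same shadow, and so must be counted apart. *)
Definition locally_finite_family (X : topologicalType) (J : Type) (E : set J)
    (P : J -> set X) : Prop :=
  forall x : X, exists2 U : set X,
    nbhs x U & finite_set [set j | E j /\ P j `&` U !=set0].

Lemma finite_set_fibres (J T : Type) (E : set J) (p : J -> T) :
  finite_set (p @` E) ->
  (forall j, E j -> finite_set [set j' | E j' /\ p j' = p j]) ->
  finite_set E.
Proof.
move=> fin_pE fin_fib.
apply: (@sub_finite_set _ _
    (\bigcup_(t in p @` E) [set j | E j /\ p j = t])).
  by move=> j Ej; exists (p j) => //; exists j.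
by apply: bigcup_finite => // _ [j Ej <-]; exact: fin_fib.
Qed.

Lemma pseudocompact_family (X : topologicalType) (J : Type) (E : set J)
    (P : J -> set X) :
  pseudocompact X -> (forall j, E j -> open (P j) /\ P j !=set0) ->
  locally_finite_family E P -> finite_set E.
Proof.
move=> pcX oneP lfP; apply: (@finite_set_fibres _ _ _ P).
  apply: pcX => [_ [j Ej <-]|x]; first exact: oneP.
  have [U xU finU] := lfP x; exists U => //.
  apply: sub_finite_set (finite_image P finU) => _ [[j Ej <-] PjU].
  by exists j.
move=> j Ej; have [_ [x Px]] := oneP j Ej; have [U xU finU] := lfP x.
apply: sub_finite_set finU => j' [Ej' Pj']; split=> //.
by exists x; split; [rewrite Pj'|exact: nbhs_singleton].
Qed.

(** If [E] were infinite, so would be a set of points of [A] chosen one in each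
    member, because a point lies in finitely many members only.  A limit point of
    that set has a neighbourhood meeting finitely many members, hence containing
    finitely many chosen points, which a T1 space allows one to remove. *)
Lemma countably_compact_at_family (X : topologicalType) (A : set X)
    (J : Type) (E : set J) (P : J -> set X) :
  accessible_space X -> countably_compact_at A ->
  (forall j, E j -> P j `&` A !=set0) ->
  locally_finite_family E P -> finite_set E.
Proof.
move=> T1 ccA PA lfP; apply: contrapT => infE.
have [j0 Ej0] := infinite_setN0 infE.
have [x0 _] := PA _ Ej0.
have /choice[p pE] : forall j, exists x, E j -> (P j `&` A) x.
  by move=> j; have [/PA[x]|] := pselect (E j); [exists x|exists x0].
have : infinite_set (p @` E).
  move=> fin_pE; apply: infE; apply: (finite_set_fibres fin_pE) => j Ej.
  have [U xU finU] := lfP (p j).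
  apply: sub_finite_set finU => j' [Ej' pj']; split=> //.
  exists (p j); split; last exact: nbhs_singleton.
  by rewrite -pj'; have [] := pE _ Ej'.
move=> /ccA[_ [j Ej <-]|x lim_x]; first by have [] := pE _ Ej.
have [U xU finU] := lfP x.
(* The chosen points that have to be removed from [U]. *)
pose D := p @` [set j | E j /\ P j `&` U !=set0] `\ x.
have closedD : closed D.
  by apply: (accessible_finite_set_closed.1 T1); exact/finite_setD/finite_image.
have xD : nbhs x (~` D).
  by apply: open_nbhs_nbhs; split; [exact: closed_openC|move=> [_]; apply].
have [y [yx [j Ej pj] [Uy]]] := lim_x _ (filterI xU xD).
apply; split; last exact/eqP.
exists j => //; split=> //; exists (p j); split; last by rewrite pj.
by have [] := pE _ Ej.
Qed.

Lemma countably_pracompact_pseudocompact (X : topologicalType) :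
  accessible_space X -> countably_pracompact X -> pseudocompact X.
Proof.
move=> T1 [A denseA ccA] F oneF lfF.
apply: (countably_compact_at_family (P := id) T1 ccA) => [U /oneF[oU U0]|//].
exact: denseA.
Qed.

(** * Continuous images of a product with a compact factor *)

Section CompactFactor.
Context (Z X Y : topologicalType) (K : set Z) (f : Z * X -> Y).
Hypotheses (compactK : compact K) (contf : continuous f).
Hypothesis f_onto :
  forall y, exists2 z, K z & exists x, f (z, x) = y.

Let shadow (G : set Y) : set X := [set x | exists2 z, K z & G (f (z, x))].

Let slice_continuous z : continuous (fun x => f (z, x)).
Proof.
move=> x; apply: (@continuous_comp _ _ _ (pair z) f x _ (@contf (z, x))).
by apply: cvg_pair => //=; exact: cvg_cst.
Qed.

(** The tube lemma, in the form of the near-covering property of [K] for the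
    product of the neighbourhoods of [x] with the cofinite filter on [E]: for each
    [z], all pairs [(x', j)] near [x] and with [j] outside a finite set satisfy
    [~ G j (f (z', x'))] for [z'] near [z], and compactness makes this uniform
    in [z]. *)
Lemma shadow_locally_finite (J : Type) (E : set J) (G : J -> set Y) :
  locally_finite_family E G ->
  locally_finite_family E (shadow \o G).
Proof.
move=> lfG x.
pose cof : set_system J := [set Q | finite_set (E `\` Q)].
have cofF : Filter cof.
  split=> [|Q Q' cQ cQ'|Q Q' QQ' cQ]; rewrite /cof /=.
  - by rewrite setDT.
  - by rewrite setDIr finite_setU.
  - by apply: sub_finite_set cQ => j [Ej nQ'j]; split=> // /QQ'.
have := (compact_near_coveringP K).1 compactK _ (filter_prod (nbhs x) cof)
  (fun xj z => E xj.2 -> ~ G xj.2 (f (z, xj.1))) _.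
case=> [z Kz|[N Q] /= [xN cQ] NQ].
  have [U fU finU] := lfG (f (z, x)).
  have [[V N] /= [zV xN] VNU] := @contf (z, x) _ fU.
  exists (V, N `*` [set j | E j -> ~ (G j `&` U !=set0)]) => /=.
    split=> //; exists (N, [set j | E j -> ~ (G j `&` U !=set0)]) => //.
    split=> //; apply: sub_finite_set finU => j [Ej /not_implyP[_ /contrapT]].
    by [].
  move=> [z' [x' j]] /= [Vz' [Nx' /= GU]] Ej Gj; apply: (GU Ej).
  by exists (f (z', x')); split=> //; apply: (VNU (z', x')).
exists N => //; apply: sub_finite_set cQ => j [Ej [x' [[z Kz Gz] Nx']]].
by split=> // Qj; apply: (NQ (x', j) _ z Kz Ej Gz).
Qed.

Lemma shadow_open (G : set Y) : open G -> open (shadow G).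
Proof.
move=> oG.
rewrite (_ : shadow G = \bigcup_(z in K) ((fun x => f (z, x)) @^-1` G)).
  apply: bigcup_open => z _.
  by apply: open_comp => // x _; exact: slice_continuous.
by apply/seteqP; split=> x [z Kz Gz]; exists z.
Qed.

Lemma shadow_neq0 (G : set Y) : G !=set0 -> shadow G !=set0.
Proof.
by move=> [y Gy]; have [z Kz [x fzx]] := f_onto y; exists x, z; rewrite ?fzx.
Qed.

Lemma pseudocompact_compact_factor : pseudocompact X -> pseudocompact Y.
Proof.
move=> pcX F oneF lfF.
apply: (pseudocompact_family (P := shadow \o id) pcX).
  by move=> U /oneF[oU U0]; split; [exact: shadow_open|exact: shadow_neq0].
exact: shadow_locally_finite.
Qed.

(** The image of [K * A] is dense.  An infinite part of it with no limit point
    would be a locally finite family of points, whose shadows all meet [A]. *)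
Lemma countably_pracompact_compact_factor :
  accessible_space X -> countably_pracompact X -> countably_pracompact Y.
Proof.
move=> T1 [A denseA ccA]; exists (f @` (K `*` A)).
  move=> O O0 oO.
  have [x [[z Kz Oz] Ax]] := denseA _ (shadow_neq0 O0) (shadow_open oO).
  by exists (f (z, x)); split=> //; exists (z, x).
move=> B BA infB; apply: contrapT => /forallNP no_lim; apply: infB.
apply: (countably_compact_at_family (P := shadow \o set1) T1 ccA).
  by move=> y /BA[[z x] [Kz Ax] fzx]; exists x; split=> //; exists z.
apply: shadow_locally_finite => y.
have /existsNP[U /not_implyP[yU noU]] := no_lim y.
exists U => //.
apply: (sub_finite_set _ (finite_set1 y)) => y' [By' [_ [-> Uy']]].
by apply: contrapT => /eqP yy'; apply: noU; exists y'; split=> //; exact/eqP.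
Qed.

End CompactFactor.

Local Open Scope group_scope.

(** * Topological semigroups and their products *)

Lemma continuous_mul_comp (B : preTopologicalSemigroupType)
    (T : topologicalType) (f g : T -> B) (x : T) :
  topological_semigroup B ->
  {for x, continuous f} -> {for x, continuous g} ->
  {for x, continuous (fun y => f y * g y)}.
Proof.
move=> [_ mul_cont] fx gx.
apply: (@continuous_comp _ _ _
  (fun y => (f y, g y)) (fun p : B * B => p.1 * p.2)); first exact: cvg_pair.
exact: mul_cont.
Qed.

Lemma prod_topology_continuous (I : choiceType) (X : topologicalType)
    (T : I -> topologicalType) (f : X -> prod_topology T) :
  (forall i, continuous (fun x => f x i)) -> continuous f.
Proof.
move=> f_cont x; apply/cvg_sup => i U.
rewrite (@nbhsE (initial_topology (fun g : forall i, T i => g i))).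
move=> [_ [[C oC <-] Cx] CU].
by apply: (filterS CU); apply: f_cont; exact: open_nbhs_nbhs.
Qed.

Lemma topological_semigroup_prod (I : choiceType)
    (T : I -> preTopologicalSemigroupType) :
  (forall i, topological_semigroup (T i)) ->
  topological_semigroup (prod_topology T).
Proof.
move=> T_top; split.
  by apply: hausdorff_product => i; case: (T_top i).
apply: prod_topology_continuous => i p.
apply: (continuous_mul_comp (T_top i)).
  apply: (cvg_comp _ (proj i) _ (@proj_continuous _ T i p.1)); exact: cvg_fst.
apply: (cvg_comp _ (proj i) _ (@proj_continuous _ T i p.2)); exact: cvg_snd.
Qed.

(** * The algebra of Brandt extensions *)

Section BrandtAlgebra.
Context (L : choiceType) (S : monoidWithZeroType).
Implicit Types (a b c d : L) (s t : S).
Local Notation B := (brandt L S).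

Lemma brandt_elt0 a b : brandt_elt a (mzero : S) b = None.
Proof. by rewrite /brandt_elt insubF ?eqxx. Qed.

Lemma brandt_elt_neq0 a b s : s != mzero -> brandt_elt a s b <> None.
Proof. by move=> s0; rewrite /brandt_elt insubT. Qed.

Lemma brandt_eltK a b (u : {s : S | s != mzero}) :
  brandt_elt a (val u) b = Some (a, u, b).
Proof. by rewrite /brandt_elt valK. Qed.

Lemma mul_brandt_elt a b c d s t :
  (brandt_elt a s b : B) * brandt_elt c t d =
  if b == c then brandt_elt a (s * t) d else None.
Proof.
rewrite {1 2}/brandt_elt; case: insubP => [u _ <-|/negPn/eqP ->]; last first.
  by rewrite mul0m brandt_elt0 if_same.
case: insubP => [v _ <- //|/negPn/eqP ->].
by rewrite mulm0 brandt_elt0 if_same.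
Qed.

Lemma brandt_mul0 (x : B) : x * (None : B) = None.
Proof. by case: x => [[[? ?] ?]|]. Qed.

(** Multiplying by the idempotents [(a, 1, a)] and [(b, 1, b)] kills everything
    outside the block at [(a, b)]. *)
Lemma brandt_corner_neq0 a b (x : B) :
  (brandt_elt a 1 a : B) * x * brandt_elt b 1 b <> None ->
  exists u, x = Some (a, u, b).
Proof.
case: x => [[[c u] d]|]; last by rewrite brandt_mul0.
rewrite -brandt_eltK mul_brandt_elt; case: eqP => // <-.
rewrite mul_brandt_elt; case: eqP => // -> _.
by exists u; rewrite brandt_eltK.
Qed.

End BrandtAlgebra.

(** * Finiteness of the index set *)

Section FiniteIndex.
Context (L : choiceType) (S : preTopologicalMonoidWithZeroType).
Context (tau : Topological (brandt L S)).
Local Notation B := (topologized tau).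
Local Notation zeroB := (None : B).
Local Notation elt a s b := (brandt_elt a s b : B).

Hypothesis B_top : topological_semigroup B.

Lemma open_setC1 (x : B) : open (~` [set x]).
Proof.
apply/closed_openC/accessible_closed_set1/hausdorff_accessible.
by case: B_top.
Qed.

(** The block at [(a, b)] minus zero, in a form whose openness is visible. *)
Definition corner (a b : L) : set B :=
  [set x | elt a 1 a * x * elt b 1 b <> zeroB].

Lemma open_corner a b : open (corner a b).
Proof.
apply: (@open_comp _ _ (fun x : B => elt a 1 a * x * elt b 1 b)
  (~` [set zeroB])); last exact: open_setC1.
move=> x _; apply: (continuous_mul_comp B_top); last exact: cvg_cst.
by apply: (continuous_mul_comp B_top); [exact: cvg_cst|exact: cvg_id].
Qed.

Hypothesis S_nontrivial : (1 : S) != mzero.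
Hypothesis B_pc : pseudocompact B.

(** Cut down to their blocks, the sets [O j] that miss [W] form a locally finite
    family: [W] meets none of them, and the block of a non-zero point meets at
    most one. *)
Lemma unit_nbhs_meet_zero_nbhs (J : Type) (c : J -> L * L) (O : J -> set B)
    (W : set B) :
  injective c -> (forall j, open (O j)) ->
  (forall j, O j (elt (c j).1 1 (c j).2)) -> nbhs zeroB W ->
  finite_set [set j | O j `&` W = set0].
Proof.
move=> c_inj oO O1 W0.
apply: (pseudocompact_family
  (P := fun j => O j `&` corner (c j).1 (c j).2) B_pc).
  move=> j OW; split; first by apply: openI => //; exact: open_corner.
  exists (elt (c j).1 1 (c j).2); split=> //; rewrite /corner /=.
  rewrite mul_brandt_elt eqxx (mul_brandt_elt (c j).1) eqxx !mulg1.
  exact: brandt_elt_neq0.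
case=> [[[a u] b]|]; last first.
  exists W => //; rewrite (_ : mkset _ = set0) //.
  apply/seteqP; split=> // j [/= OW [x [[Ox _] Wx]]].
  by suff : (O j `&` W) x by rewrite OW.
exists (corner a b).
  apply: open_nbhs_nbhs; split; first exact: open_corner.
  rewrite /corner /= -brandt_eltK mul_brandt_elt eqxx mul_brandt_elt eqxx.
  by rewrite mul1g mulg1; apply: brandt_elt_neq0; exact: (valP u).
have [[j0 cj0]|noj] := pselect (exists j, c j = (a, b)).
  apply: (sub_finite_set _ (finite_set1 j0)) => j [_ [x [[_ xj] xab]]].
  have [v xv] := brandt_corner_neq0 xj.
  have [w] := brandt_corner_neq0 xab; rewrite xv => -[c1 _ c2].
  by apply: c_inj; rewrite cj0 -c1 -c2; case: (c j).
rewrite (_ : mkset _ = set0) //.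
apply/seteqP; split=> // j [_ [x [[_ xj] xab]]].
have [v xv] := brandt_corner_neq0 xj.
have [w] := brandt_corner_neq0 xab; rewrite xv => -[c1 _ c2].
by apply: noj; exists j; rewrite -c1 -c2; case: (c j).
Qed.

(** For all but finitely many [g] both [(a, 1, g)] and [(g, 1, a)] have small
    neighbourhoods that meet the given neighbourhoods of zero.  No such [g]
    exists, since it would produce a product close both to [(a, 1, a)] and to
    zero. *)
Lemma finite_index : finite_set [set: L].
Proof.
have [[a]|noL] := pselect (inhabited L); last first.
  rewrite (_ : [set: L] = set0) //; apply/seteqP; split=> // a _.
  by apply: noL; constructor.
have [T2 mul_cont] := B_top.
have : elt a 1 a != zeroB by apply/eqP; exact: brandt_elt_neq0.
move: T2; rewrite open_hausdorff => /[apply].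
move=> -[[N U] /= [/[!inE] N1 U0] [oN oU NU]].
have nbU : nbhs ((zeroB, zeroB) : B * B)
    ((fun p : B * B => p.1 * p.2) @^-1` U).
  by apply: mul_cont; exact: open_nbhs_nbhs.
have [[W W'] /= [W0 W'0] WW'U] := nbU.
have /choice[PQ PQP] : forall g : L, exists PQ : set B * set B,
    [/\ open PQ.1, open PQ.2, PQ.1 (elt a 1 g), PQ.2 (elt g 1 a) &
        forall x y, PQ.1 x -> PQ.2 y -> N (x * y)].
  move=> g; have := mul_cont (elt a 1 g, elt g 1 a) N.
  rewrite /= mul_brandt_elt eqxx mul1g => /(_ (open_nbhs_nbhs (conj oN N1))).
  move=> [[P Q] /= [Pa Qa] PQN]; exists (P°, Q°) => /=.
  split; [exact: open_interior|exact: open_interior|by []|by []|].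
  by move=> x y /interior_subset Px /interior_subset Qy; apply: (PQN (x, y)).
have finP : finite_set [set g | (PQ g).1 `&` W = set0].
  apply: (@unit_nbhs_meet_zero_nbhs L (fun g => (a, g)) _ _ _ _ _ W0)
    => [g h []|g|g] //.
    by have [] := PQP g.
  by have [] := PQP g.
have finQ : finite_set [set g | (PQ g).2 `&` W' = set0].
  apply: (@unit_nbhs_meet_zero_nbhs L (fun g => (g, a)) _ _ _ _ _ W'0)
    => [g h []|g|g] //.
    by have [] := PQP g.
  by have [] := PQP g.
have : finite_set ([set g | (PQ g).1 `&` W = set0] `|`
                   [set g | (PQ g).2 `&` W' = set0]).
  by rewrite finite_setU.
apply: sub_finite_set => g _; apply: contrapT.
move=> /not_orP[/= /eqP/set0P[x [Px Wx]]] /eqP/set0P[y [Qy Wy]].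
have [_ _ _ _ PQN] := PQP g.
have : (N `&` U) (x * y) by split; [exact: PQN|exact: (WW'U (x, y))].
by rewrite NU.
Qed.

End FiniteIndex.

(** * Covering an extension, and a product of extensions, by blocks *)

Section Blocks.
Context (L : choiceType) (S : preTopologicalMonoidWithZeroType).
Context (tau : Topological (brandt L S)).
Local Notation B := (topologized tau).

Lemma brandt_elt_continuous a b :
  topological_brandt_extension tau ->
  continuous (fun s : S => brandt_elt a s b : B).
Proof.
move=> [B_top [c [_ c_cont _]]] s.
(* Only the block at the index [c] is known to be a copy of [S]. *)
rewrite (_ : (fun s => _) = (fun s : S =>
    (brandt_elt a 1 c : B) * brandt_elt c s c * brandt_elt c 1 b)).
  apply: (continuous_mul_comp B_top); last exact: cvg_cst.
  by apply: (continuous_mul_comp B_top); [exact: cvg_cst|exact: c_cont].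
apply/funext => t.
by rewrite mul_brandt_elt eqxx mul_brandt_elt eqxx mul1g mulg1.
Qed.

(** If [1 = 0] in [S], the index set may be infinite, but the extension is
    reduced to zero. *)
Lemma finite_block_cover : [set: L] !=set0 ->
  topological_brandt_extension tau -> pseudocompact B ->
  exists2 A : set (L * L), finite_set A &
    forall x : B, exists2 ab, A ab & exists s, brandt_elt ab.1 s ab.2 = x.
Proof.
move=> [a _] [B_top _] B_pc.
have [S1|S1] := eqVneq (1 : S) mzero.
  exists [set (a, a)] => // x; exists (a, a) => //; exists 1.
  rewrite S1 brandt_elt0; case: x => [[[b u] c]|//].
  by have := valP u; rewrite -[val u]mul1g S1 mul0m eqxx.
exists [set: L * L].
  by rewrite -setXTT; apply: finite_setX; exact: finite_index B_pc.
case=> [[[b u] c]|].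
  by exists (b, c) => //; exists (val u); exact: brandt_eltK.
by exists (a, a) => //; exists mzero; exact: brandt_elt0.
Qed.

End Blocks.

Lemma brandt_elt_prod_continuous (I : choiceType) (L : I -> choiceType)
    (S : I -> preTopologicalMonoidWithZeroType)
    (tau : forall i, Topological (brandt (L i) (S i))) :
  (forall i, topological_brandt_extension (tau i)) ->
  continuous (fun kx :
      prod_topology (fun i => discrete_topology (L i * L i)%type) *
      prod_topology S =>
    (fun i => brandt_elt (kx.1 i).1 (kx.2 i) (kx.1 i).2)
    : prod_topology (fun i => topologized (tau i))).
Proof.
move=> tau_ext; apply: prod_topology_continuous => i [k x] U /= Ui.
have kU : nbhs k [set k' | k' i = k i].
  exact: (@proj_continuous _
    (fun i => discrete_topology (L i * L i)%type) i k _ (discrete_set1 (k i))).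
have xU : nbhs x [set x' | U (brandt_elt (k i).1 (x' i) (k i).2)].
  apply: (@proj_continuous _ S i x [set s | U (brandt_elt (k i).1 s (k i).2)]).
  exact: (brandt_elt_continuous (tau_ext i)).
exists ([set k' | k' i = k i],
        [set x' | U (brandt_elt (k i).1 (x' i) (k i).2)]); first by split.
by move=> [k' x'] [/= ->].
Qed.

Lemma brandt_product_cover (I : choiceType) (L : I -> choiceType)
    (L_neq0 : forall i, [set: L i] !=set0)
    (S : I -> preTopologicalMonoidWithZeroType)
    (tau : forall i, Topological (brandt (L i) (S i))) :
  (forall i, topological_brandt_extension (tau i)) ->
  (forall i, pseudocompact (topologized (tau i))) ->
  exists2 K : set (prod_topology (fun i => discrete_topology (L i * L i)%type)),
    compact K &
    forall y : prod_topology (fun i => topologized (tau i)),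
    exists2 k, K k & exists x : prod_topology S,
      (fun i => brandt_elt (k i).1 (x i) (k i).2) = y.
Proof.
move=> tau_ext B_pc.
have Acov : forall i, exists A : set (L i * L i),
    finite_set A /\ forall x : topologized (tau i),
      exists2 ab, A ab & exists s, brandt_elt ab.1 s ab.2 = x.
  move=> i; have [A] := finite_block_cover (L_neq0 i) (tau_ext i) (B_pc i).
  by exists A.
pose A i := projT1 (cid (Acov i)).
have AP i := projT2 (cid (Acov i)).
exists [set k | forall i, A i (k i)].
  apply: (@tychonoff _ (fun i => discrete_topology (L i * L i)%type)) => i.
  by apply: finite_compact; case: (AP i).
move=> y.
have yE : forall i, exists ks : L i * L i * S i,
    A i ks.1 /\ brandt_elt ks.1.1 ks.2 ks.1.2 = y i.
  move=> i; have [_ /(_ (y i))[ab Aab [s yE]]] := AP i.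
  by exists (ab, s).
pose ks i := projT1 (cid (yE i)).
have ksP i := projT2 (cid (yE i)).
exists (fun i => (ks i).1); first by move=> i; case: (ksP i).
exists (fun i => (ks i).2); apply: functional_extensionality_dep => i.
by case: (ksP i).
Qed.

Local Close Scope group_scope.

Theorem theorem2p17 (I : choiceType) (I_neq0 : [set: I] !=set0)
    (L : I -> choiceType) (L_neq0 : forall i, [set: L i] !=set0)
    (S : I -> preTopologicalMonoidWithZeroType)
    (S_top : forall i, topological_semigroup (S i))
    (tau : forall i, Topological (brandt (L i) (S i)))
    (tau_ext : forall i, topological_brandt_extension (tau i)) :
  ((forall i, pseudocompact (S i)) ->
   (forall i, pseudocompact (topologized (tau i))) ->
   hausdorff_space (prod_topology S) /\ pseudocompact (prod_topology S) ->
   topological_semigroup (prod_topology (fun i => topologized (tau i))) /\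
   pseudocompact (prod_topology (fun i => topologized (tau i)))) /\
  ((forall i, countably_pracompact (S i)) ->
   (forall i, countably_pracompact (topologized (tau i))) ->
   hausdorff_space (prod_topology S) /\
     countably_pracompact (prod_topology S) ->
   topological_semigroup (prod_topology (fun i => topologized (tau i))) /\
   countably_pracompact (prod_topology (fun i => topologized (tau i)))).
Proof.
have B_top i : topological_semigroup (topologized (tau i)) by case: (tau_ext i).
have prod_top := topological_semigroup_prod B_top.
have cont := brandt_elt_prod_continuous tau_ext.
split=> _ B_c [S_T2 S_c]; split=> //.
  have [K K_compact K_onto] := brandt_product_cover L_neq0 tau_ext B_c.
  exact: pseudocompact_compact_factor K_compact cont K_onto S_c.
have B_pc i : pseudocompact (topologized (tau i)).
  apply: countably_pracompact_pseudocompact (B_c i).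
  by apply: hausdorff_accessible; case: (B_top i).
have [K K_compact K_onto] := brandt_product_cover L_neq0 tau_ext B_pc.
apply: countably_pracompact_compact_factor K_compact cont K_onto _ S_c.
exact: hausdorff_accessible.
Qed.
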